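(* Let $k\ge 1$, let $S\subseteq\{1,\ldots,k\}$ and let $c_1,\ldots,c_k$ be nonnegative integers. Let $m_i=1$ if $i\in S$ and let $m_i=c_i$ if $i\notin S$. Then for all $0\le j<k$, $$f_j(c_1,\ldots,c_k)=\sum_{h=0}^{m_{j+1}} f_{j+1}(c_1,\ldots,c_j,c_{j+1}-h,c_{j+2},\ldots,c_k).$$
   Context: The set $S\subseteq\{1,\ldots,k\}$ is fixed throughout. For nonnegative integers $a_1,\ldots,a_k$, let $n=a_1+\cdots+a_k$ and partition $\{1,\ldots,n\}$ into consecutive blocks $A_1,\ldots,A_k$ (in this order) with $|A_i|=a_i$, i.e. $A_i=\{a_1+\cdots+a_{i-1}+1,\ldots,a_1+\cdots+a_i\}$ (blocks may be empty). An $(a_1,\ldots,a_k,S)$-permutation is a permutation $\pi$ of $\{1,\ldots,n\}$ that descends within each block $A_i$ with $i\in S$ (that is, $\pi(r)>\pi(r+1)$ whenever $r,r+1\in A_i$) and ascends within each block $A_i$ with $i\notin S$ (that is, $\pi(r)<\pi(r+1)$ whenever $r,r+1\in A_i$); no condition is imposed between different blocks. A fixed point in $A_i$ is an $r\in A_i$ with $\pi(r)=r$. For $0\le j\le k$, $f_j(a_1,\ldots,a_k)$ denotes the number of $(a_1,\ldots,a_k,S)$-permutations with no fixed points in the blocks $A_i$ for all $i\le j$ (so $f_0$ counts all $(a_1,\ldots,a_k,S)$-permutations). By convention $f_j(a_1,\ldots,a_k)=0$ if some $a_i$ is negative. *)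

(* Defs.v *)
From mathcomp Require Import all_boot all_order all_algebra all_fingroup.
Set Implicit Arguments.
Unset Strict Implicit.
Unset Printing Implicit Defensive.

(* Indices are 0-based: the block A_{i+1} is block i : 'I_k,
   and the position/value r+1 of {1, ..., n} is r : 'I_n.  The shift preserves
   fixed points and the order. *)

Definition total_size (k : nat) (a : 'I_k -> nat) : nat := \sum_(i < k) a i.

Definition block_start (k : nat) (a : 'I_k -> nat) (i : 'I_k) : nat :=
  \sum_(l < k | l < i) a l.

Definition block (k : nat) (a : 'I_k -> nat) (i : 'I_k) :
    {set 'I_(total_size a)} :=
  [set r : 'I_(total_size a) | block_start a i <= r < block_start a i + a i].

Definition is_block_perm (k : nat) (S : {set 'I_k}) (a : 'I_k -> nat)
    (p : 'S_(total_size a)) : bool :=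
  [forall i : 'I_k, forall r in block a i, forall s in block a i,
    (val s == r.+1) ==> (if i \in S then p s < p r else p r < p s)].

(* In 1-based terms, "no fixed point in A_1, ..., A_j". *)
Definition no_fixpoint_upto (k : nat) (a : 'I_k -> nat) (j : nat)
    (p : 'S_(total_size a)) : bool :=
  [forall i : 'I_k, (i < j) ==> [forall r in block a i, p r != r]].

Definition count_perms (k : nat) (S : {set 'I_k}) (j : nat)
    (a : 'I_k -> nat) : nat :=
  #|[set p : 'S_(total_size a) | is_block_perm S p && no_fixpoint_upto j p]|.

(* f_j(a_1, ..., a_k), for integer arguments: 0 as soon as some a_i < 0. *)
Definition f (k : nat) (S : {set 'I_k}) (j : nat) (a : 'I_k -> int) : nat :=
  if [forall i, (0 <= a i)%R] then count_perms S j (fun i => `|a i|%N) else 0.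

(* The upper summation bound m_i. *)
Definition m (k : nat) (S : {set 'I_k}) (c : 'I_k -> nat) (i : 'I_k) : nat :=
  if i \in S then 1 else c i.

(* Main.v *)
Require Import Defs.
From mathcomp Require Import all_boot all_order all_algebra all_fingroup.
From mathcomp Require Import zify.

(** Classify the permutations counted by the left-hand side by their fixed
    points in block j.  Deleting a fixed point t (as a position and as a value)
    and closing the gap leaves a permutation of one element fewer, in which
    block j is shorter by one and all order relations inside blocks survive.
    The question is when the deletion can be undone in exactly one way.

    Inside block j, whether ascending or descending, the excess p x - x never
    changes sign more than once: it is weakly increasing in an ascending block
    and strictly decreasing in a descending one.  A point t can therefore be
    reinserted as a fixed point exactly where the sign changes, and this
    crossing place is determined by the shorter permutation.
    - In a descending block the excess vanishes at most once, so there is at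
      most one fixed point.  After its deletion earlier positions have larger
      values than t and later ones smaller, so no new fixed point appears.
    - In an ascending block the fixed points form a run that starts at the
      crossing place.  Deleting the first point of the run is invertible, with
      any number of fixed points allowed to remain in block j.

    The equivalence between the first fixed point being t and the crossing
    place being t is insert_fixed_crossing on a single interval and
    insert_fixed_block for the whole sequence of blocks.  Summing over t gives,
    as count_perms_succ, that f_j(..., d+1, ...) equals
      f_(j+1)(..., d+1, ...) + f_(j+1)(..., d, ...)   when j is in S,
      f_(j+1)(..., d+1, ...) + f_j(..., d, ...)       otherwise.
    The first recurrence is the claim for a descending block, and iterating
    the second until block j is empty is the claim for an ascending one. *)

Set Implicit Arguments.
Unset Strict Implicit.
Unset Printing Implicit Defensive.

(** * Blocks after changing the size of one of them *)

Definition update {k : nat} (a : 'I_k -> nat) (j : 'I_k) (d : nat) : 'I_k -> nat :=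
  fun i => if i == j then d else a i.

Lemma eq_total_size (k : nat) (a b : 'I_k -> nat) :
  a =1 b -> total_size a = total_size b.
Proof. by move=> eq_ab; apply: eq_bigr => i _. Qed.

Lemma eq_block_start (k : nat) (a b : 'I_k -> nat) :
  a =1 b -> block_start a =1 block_start b.
Proof. by move=> eq_ab i; apply: eq_bigr => l _. Qed.

Lemma block_end_le_sum (k : nat) (a : 'I_k -> nat) (i : 'I_k) (P : pred 'I_k) :
  P i -> (forall l : 'I_k, l < i -> P l) ->
  block_start a i + a i <= \sum_(l | P l) a l.
Proof.
move=> Pi Plt; rewrite (bigD1 i) //= addnC leq_add2l.
rewrite [leqRHS](bigID (fun l : 'I_k => l < i)) /= -[leqLHS]addn0 leq_add //.
rewrite /block_start [leqRHS](eq_bigl (fun l : 'I_k => l < i)) // => l.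
case: (ltnP l i) => [lt_li | _]; last by rewrite andbF.
by rewrite (Plt l lt_li) -val_eqE /= neq_ltn lt_li.
Qed.

Lemma block_end_total (k : nat) (a : 'I_k -> nat) (i : 'I_k) :
  block_start a i + a i <= total_size a.
Proof. exact: block_end_le_sum. Qed.

Lemma block_end_start (k : nat) (a : 'I_k -> nat) (i l : 'I_k) :
  i < l -> block_start a i + a i <= block_start a l.
Proof. by move=> lt_il; apply: block_end_le_sum => // x /ltn_trans->. Qed.

Section UpdateSizes.
Variables (k : nat) (a : 'I_k -> nat) (j : 'I_k).

Lemma update_same (d : nat) : update a j d j = d.
Proof. by rewrite /update eqxx. Qed.

Lemma update_other (d : nat) (i : 'I_k) : i != j -> update a j d i = a i.
Proof. by rewrite /update => /negPf->. Qed.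

Lemma total_size_succ (d : nat) :
  total_size (update a j d.+1) = (total_size (update a j d)).+1.
Proof.
rewrite /total_size (bigD1 j) //= [in RHS](bigD1 j) //= /update eqxx addSn.
by congr (_ + _).+1; apply: eq_bigr => i ne_ij; rewrite (negPf ne_ij).
Qed.

Lemma block_start_succ (d : nat) (i : 'I_k) :
  block_start (update a j d.+1) i = block_start (update a j d) i + (j < i).
Proof.
rewrite /block_start; case: (boolP (j < i)) => [lt_ji | le_ij].
  rewrite (bigD1 j) //= [in RHS](bigD1 j) //= /update eqxx addn1 addSn.
  by congr (_ + _).+1; apply: eq_bigr => l /andP[_ ne_lj]; rewrite (negPf ne_lj).
rewrite addn0; apply: eq_bigr => l lt_li; rewrite !update_other //;
  by apply: contraNneq le_ij => <-.
Qed.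

End UpdateSizes.

(** * Permutations as functions on the natural numbers *)

(** Extending a permutation by the identity keeps the size out of the type, so
    that permutations for different block sizes can be compared position by
    position. *)
Definition nat_perm {n : nat} (p : 'S_n) (x : nat) : nat :=
  oapp (fun i : 'I_n => val (p i)) x (insub x).

Lemma nat_perm_val (n : nat) (p : 'S_n) (i : 'I_n) : nat_perm p i = p i.
Proof. by rewrite /nat_perm valK. Qed.

Lemma nat_perm_ord (n : nat) (p : 'S_n) (x : nat) (lt_xn : x < n) :
  nat_perm p x = p (Ordinal lt_xn).
Proof. by rewrite -nat_perm_val. Qed.

Lemma nat_perm_id (n : nat) (p : 'S_n) (x : nat) : n <= x -> nat_perm p x = x.
Proof. by move=> le_nx; rewrite /nat_perm insubF // ltnNge le_nx. Qed.

(** The counterpart of [lift_perm t t] on functions: a gap is opened at t both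
    among the positions and among the values, and t is mapped to itself. *)
Definition insert_fixed (t : nat) (g : nat -> nat) (x : nat) : nat :=
  if x == t then t else bump t (g (unbump t x)).

Lemma nat_perm_lift (n : nat) (t : 'I_n.+1) (q : 'S_n) :
  nat_perm (lift_perm t t q) =1 insert_fixed t (nat_perm q).
Proof.
move=> x; rewrite /insert_fixed; case: (ltnP x n.+1) => [lt_xn | le_nx].
  rewrite (nat_perm_ord _ lt_xn).
  case: (unliftP t (Ordinal lt_xn)) => [i | ] def_x; last first.
    by rewrite def_x lift_perm_id -[x]/(val (Ordinal lt_xn)) def_x eqxx.
  rewrite def_x lift_perm_lift -[x]/(val (Ordinal lt_xn)) def_x /=.
  by rewrite eq_sym (negPf (neq_bump _ _)) bumpK nat_perm_val.
have lt_tn := ltn_ord t.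
rewrite nat_perm_id // ifN; last lia.
by rewrite nat_perm_id /unbump /bump; lia.
Qed.

(** * Monotone and fixed-point-free intervals *)

(** The flag [b] stands for descending; it will be instantiated with
    [j \in S]. *)
Definition monotone_step (b : bool) (u v : nat) : bool :=
  if b then v < u else u < v.

Definition monotone_on (b : bool) (s l : nat) (g : nat -> nat) : bool :=
  all (fun x => monotone_step b (g x) (g x.+1)) (iota s l.-1).

Definition deranged_on (s l : nat) (g : nat -> nat) : bool :=
  all (fun x => g x != x) (iota s l).

Lemma monotone_onP (b : bool) (s l : nat) (g : nat -> nat) :
  reflect (forall x, s <= x -> x.+1 < s + l -> monotone_step b (g x) (g x.+1))
          (monotone_on b s l g).
Proof.
apply: (iffP allP) => mono x; first by move=> *; apply: mono; rewrite mem_iota; lia.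
by rewrite mem_iota => ?; apply: mono; lia.
Qed.

Lemma deranged_onP (s l : nat) (g : nat -> nat) :
  reflect (forall x, s <= x -> x < s + l -> g x <> x) (deranged_on s l g).
Proof.
apply: (iffP allP) => nofix x.
  by move=> *; apply/eqP/nofix; rewrite mem_iota; lia.
by rewrite mem_iota => /andP[? ?]; apply/eqP/nofix.
Qed.

Section NatPredicates.
Variables (k : nat) (S : {set 'I_k}) (a : 'I_k -> nat).

Definition block_monotone (g : nat -> nat) : bool :=
  [forall i, monotone_on (i \in S) (block_start a i) (a i) g].

Definition block_deranged (j : nat) (g : nat -> nat) : bool :=
  [forall i : 'I_k, (i < j) ==> deranged_on (block_start a i) (a i) g].

Lemma is_block_permE (p : 'S_(total_size a)) :
  is_block_perm S p = block_monotone (nat_perm p).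
Proof.
apply: eq_forallb => i; apply/forall_inP/monotone_onP => [mono x le_sx lt_xe | mono r].
  have lt_x1n : x.+1 < total_size a by apply: leq_trans lt_xe (block_end_total a i).
  have lt_xn := ltnW lt_x1n.
  rewrite (nat_perm_ord _ lt_x1n) (nat_perm_ord _ lt_xn).
  have x_in : Ordinal lt_xn \in block a i by rewrite inE /=; lia.
  have /forall_inP/(_ (Ordinal lt_x1n)) := mono _ x_in.
  by rewrite inE /= eqxx; apply; lia.
rewrite inE => /andP[le_sr _]; apply/forall_inP => s; rewrite inE => /andP[_ lt_se].
apply/implyP => /eqP def_s; rewrite def_s in lt_se.
by have := mono r le_sr lt_se; rewrite -def_s !nat_perm_val.
Qed.

Lemma no_fixpoint_uptoE (j : nat) (p : 'S_(total_size a)) :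
  no_fixpoint_upto j p = block_deranged j (nat_perm p).
Proof.
apply: eq_forallb => i; congr (_ ==> _).
apply/forall_inP/deranged_onP => [nofix x le_sx lt_xe | nofix r].
  have lt_xn : x < total_size a by apply: leq_trans lt_xe (block_end_total a i).
  rewrite (nat_perm_ord _ lt_xn) => fix_x.
  have /eqP[] : p (Ordinal lt_xn) != Ordinal lt_xn by apply: nofix; rewrite inE /= le_sx.
  exact: val_inj.
rewrite inE => /andP[le_sr lt_re]; apply/eqP => fix_r.
by apply: (nofix r) => //; rewrite nat_perm_val fix_r.
Qed.

Lemma count_permsE (j n : nat) : total_size a = n ->
  count_perms S j a =
  #|[set p : 'S_n | block_monotone (nat_perm p) && block_deranged j (nat_perm p)]|.
Proof.
move<-; apply: eq_card => p.
by rewrite !inE is_block_permE no_fixpoint_uptoE.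
Qed.

End NatPredicates.

Lemma eq_count_perms (k : nat) (S : {set 'I_k}) (j : nat) (a b : 'I_k -> nat) :
  a =1 b -> count_perms S j a = count_perms S j b.
Proof.
move=> eq_ab; rewrite (count_permsE S j (eq_total_size eq_ab)) (count_permsE S j erefl).
apply: eq_card => p; rewrite !inE; congr (_ && _); apply: eq_forallb => i;
  by rewrite (eq_block_start eq_ab) eq_ab.
Qed.

Lemma block_derangedS (k : nat) (a : 'I_k -> nat) (j : 'I_k) (g : nat -> nat) :
  block_deranged a j.+1 g =
  block_deranged a j g && deranged_on (block_start a j) (a j) g.
Proof.
apply/forallP/andP => [der | [/forallP der der_j] i].
  split; last by have := der j; rewrite ltnSn.
  by apply/forallP => i; apply/implyP => lt_ij; have := der i; rewrite (ltnW lt_ij : i < j.+1).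
apply/implyP; rewrite ltnS leq_eqVlt => /orP[/eqP eq_ij | lt_ij].
  by rewrite (val_inj eq_ij : i = j).
by have := der i; rewrite lt_ij.
Qed.

(** * First fixed point and crossing place in an interval *)

Definition first_fixed (s l : nat) (g : nat -> nat) (t : nat) : bool :=
  [&& s <= t, t < s + l, g t == t & deranged_on s (t - s) g].

(** The place t where the graph of [g] crosses the diagonal.  A fixed point
    counts as lying past the crossing in the ascending case, so that the
    inserted point becomes the first of the fixed points; in the descending
    case both sides are strict, which excludes fixed points.  The value
    [t = s + l], just after the interval, means that no crossing occurs inside
    and that the new fixed point goes to the end. *)
Definition crossing (b : bool) (s l : nat) (g : nat -> nat) (t : nat) : bool :=
  [&& s <= t, t <= s + l &
    all (fun x => if b then (x < t) && (x < g x) || (t <= x) && (g x < x)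
                  else (x < t) == (g x < x)) (iota s l)].

Lemma crossingP (b : bool) (s l : nat) (g : nat -> nat) (t : nat) :
  reflect [/\ s <= t, t <= s + l,
              forall x, s <= x -> x < t -> if b then x < g x else g x < x
            & forall x, t <= x -> x < s + l -> if b then g x < x else x <= g x]
          (crossing b s l g t).
Proof.
apply: (iffP and3P) => -[le_st le_te]; last first.
  move=> below above; split=> //; apply/allP => x; rewrite mem_iota => ?.
  by have := below x; have := above x; case: b {below above}; lia.
move/allP => cross; split=> // x ? ?; have := cross x; rewrite mem_iota;
  case: b {cross}; lia.
Qed.

Lemma first_fixedP (s l : nat) (g : nat -> nat) (t : nat) :
  reflect [/\ s <= t, t < s + l, g t = t & forall x, s <= x -> x < t -> g x <> x]
          (first_fixed s l g t).
Proof.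
apply: (iffP and4P) => -[le_st lt_te].
  move=> /eqP fix_t /deranged_onP nofix; split=> // x ? ?; apply: nofix; lia.
by move=> /eqP fix_t nofix; split=> //; apply/deranged_onP => x ? ?; apply: nofix; lia.
Qed.

(** An increasing sequence of integers grows by at least one at each step, so
    [g x - x] is weakly increasing; the inequality avoids subtraction. *)
Lemma ascending_gap (s l : nat) (g : nat -> nat) (x y : nat) :
  monotone_on false s l g -> s <= x -> x <= y -> y < s + l -> g x + y <= g y + x.
Proof.
move=> /monotone_onP mono le_sx /subnKC <-.
elim: (y - x) => [|h IHh]; first by rewrite addn0.
rewrite addnS => lt_e; have := mono (x + h); rewrite /monotone_step; move: IHh; lia.
Qed.

Lemma descending_lt (s l : nat) (g : nat -> nat) (x y : nat) :
  monotone_on true s l g -> s <= x -> x < y -> y < s + l -> g y < g x.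
Proof.
move=> /monotone_onP mono le_sx /subnKC <-.
elim: (y - x.+1) => [|h IHh].
  by rewrite addn0 => lt_e; apply: (mono x).
rewrite addnS => lt_e; have := mono (x.+1 + h); rewrite /monotone_step; move: IHh; lia.
Qed.

Lemma insert_fixed_lt (t : nat) (g : nat -> nat) (x : nat) :
  x < t -> insert_fixed t g x = bump t (g x).
Proof. by move=> lt_xt; rewrite /insert_fixed /unbump ltnNge ltnW // subn0 ltn_eqF. Qed.

Lemma insert_fixed_gt (t : nat) (g : nat -> nat) (x : nat) :
  t <= x -> insert_fixed t g x.+1 = bump t (g x).
Proof. by move=> le_tx; rewrite /insert_fixed /unbump ltnS le_tx subn1 gtn_eqF. Qed.

Lemma insert_fixed_at (t : nat) (g : nat -> nat) : insert_fixed t g t = t.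
Proof. by rewrite /insert_fixed eqxx. Qed.

(** Suppose that t is the first fixed point of [p].  On an ascending interval
    the excess is weakly increasing and vanishes at t, hence is negative before
    t and nonnegative after; on a descending interval it is positive before t
    and negative after.  Closing the gap preserves these signs.  Conversely, at
    the crossing place the values before and after are separated by t, so that
    inserting t keeps the interval monotone. *)
Lemma insert_fixed_crossing (b : bool) (s d : nat) (g : nat -> nat) (t : nat) :
  let p := insert_fixed t g in
  monotone_on b s d.+1 p && first_fixed s d.+1 p t =
  monotone_on b s d g && crossing b s d g t.
Proof.
move=> p.
have p_lt x : x < t -> p x = bump t (g x) by apply: insert_fixed_lt.
have p_gt x : t <= x -> p x.+1 = bump t (g x) by apply: insert_fixed_gt.
have p_t : p t = t by apply: insert_fixed_at.
apply/andP/andP => [[mono /first_fixedP[le_st lt_te _ nofix]] |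
                    [mono /crossingP[le_st le_te below above]]].
  split.
    apply/monotone_onP => x le_sx lt_xe.
    have /(_ x.+1) mono1 := elimT (monotone_onP _ _ _ _) mono.
    have /(_ x) mono0 := elimT (monotone_onP _ _ _ _) mono.
    case: (ltngtP x.+1 t) => [lt_xt | lt_tx | eq_xt].
    - move: mono0; rewrite !p_lt //; last exact: ltnW.
      by rewrite /monotone_step /bump; case: (b); lia.
    - by move: mono1; rewrite !p_gt //; rewrite /monotone_step /bump; case: (b); lia.
    (* The neighbours x and x.+1 surround the deleted point, hence are compared
       through the two consecutive steps of p at t. *)
    have lt_xt : x < t by rewrite -eq_xt.
    have le_tx1 : t <= x.+1 by rewrite eq_xt.
    move: mono0 mono1; rewrite (p_gt x.+1) // (p_lt x) // eq_xt p_t.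
    by rewrite /monotone_step /bump; case: (b); lia.
  apply/crossingP; split=> [||x|x].
  - by [].
  - lia.
  - move=> le_sx lt_xt; have := nofix x le_sx lt_xt.
    case: b mono => mono; rewrite p_lt //.
      have := descending_lt mono le_sx lt_xt lt_te; rewrite (p_lt x) // p_t /bump; lia.
    have := ascending_gap mono le_sx (ltnW lt_xt) lt_te; rewrite (p_lt x) // p_t /bump; lia.
  - move=> le_tx lt_xe; have lt_x1e : x.+1 < s + d.+1 by lia.
    case: b mono => mono.
      have := @descending_lt _ _ _ t x.+1 mono le_st (leq_trans le_tx _) lt_x1e.
      rewrite (p_gt x) // p_t /bump; lia.
    have := @ascending_gap _ _ _ t x.+1 mono le_st (leqW le_tx) lt_x1e.
    rewrite (p_gt x) // p_t /bump; lia.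
split.
  apply/monotone_onP => x le_sx lt_xe.
  have /(_ x) mono0 := elimT (monotone_onP _ _ _ _) mono.
  have /(_ x.-1) mono1 := elimT (monotone_onP _ _ _ _) mono.
  case: (ltngtP x t) => [lt_xt | lt_tx | eq_xt].
  - case: (ltngtP x.+1 t) => [lt_x1t | | eq_x1t]; last 1 first.
    + rewrite eq_x1t p_t p_lt //; have := below x le_sx lt_xt; rewrite /monotone_step /bump.
      by case: (b); lia.
    + move: mono0; rewrite !p_lt // /monotone_step /bump; case: (b); lia.
    + lia.
  - case: x lt_tx mono1 {mono0} le_sx lt_xe => // x lt_tx /= mono1 le_sx lt_xe.
    rewrite !p_gt //; last lia.
    by move: mono1; rewrite /monotone_step /bump; case: (b); lia.
  rewrite eq_xt p_t p_gt //; have := above t; rewrite /monotone_step /bump.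
  by case: (b); lia.
apply/first_fixedP; split=> // [|x le_sx lt_xt]; first lia.
rewrite p_lt //; have := below x le_sx lt_xt; rewrite /bump; case: (b); lia.
Qed.

Lemma first_fixed_unique (s l : nat) (g : nat -> nat) (t u : nat) :
  first_fixed s l g t -> first_fixed s l g u -> t = u.
Proof.
move=> /first_fixedP[le_st lt_te fix_t no_t] /first_fixedP[le_su lt_ue fix_u no_u].
by case: (ltngtP t u) => // [lt_tu | lt_ut]; [case: (no_u t) | case: (no_t u)].
Qed.

Lemma first_fixed_exists (s l : nat) (g : nat -> nat) :
  ~~ deranged_on s l g -> exists t, first_fixed s l g t.
Proof.
rewrite -has_predC => /hasP has_fix.
have ex_fix : exists x, [&& s <= x, x < s + l & g x == x].
  by case: has_fix => x; rewrite mem_iota /= negbK => /andP[? ?] ?; exists x; apply/and3P.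
case: (ex_minnP ex_fix) => t /and3P[le_st lt_te /eqP fix_t] min_t; exists t.
apply/first_fixedP; split=> // x le_sx lt_xt fix_x.
by have := min_t x; rewrite fix_x eqxx; lia.
Qed.

Lemma crossing_unique (b : bool) (s l : nat) (g : nat -> nat) (t u : nat) :
  crossing b s l g t -> crossing b s l g u -> t = u.
Proof.
move=> /crossingP[le_st le_te below_t above_t] /crossingP[le_su le_ue below_u above_u].
case: (ltngtP t u) => // [lt_tu | lt_ut].
  by have := below_u t; have := above_t t; case: (b); lia.
by have := below_t u; have := above_u u; case: (b); lia.
Qed.

(** The crossing place is the first position weakly past the diagonal, or the
    end of the interval.  In the descending case a position that is not past
    the diagonal could still be fixed, hence the extra hypothesis. *)
Lemma crossing_exists (b : bool) (s l : nat) (g : nat -> nat) :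
  monotone_on b s l g -> b ==> deranged_on s l g ->
  exists t, crossing b s l g t.
Proof.
move=> mono der.
have ex_t : exists x, (s <= x <= s + l) &&
    ((x == s + l) || (if b then g x < x else x <= g x)).
  by exists (s + l); rewrite leq_addr leqnn eqxx.
case: (ex_minnP ex_t) => t /andP[/andP[le_st le_te] cross_t] min_t; exists t.
apply/crossingP; split=> // x.
  move=> le_sx lt_xt; have := min_t x.
  by case: b der {mono cross_t min_t ex_t} => [/deranged_onP/(_ x) | _]; lia.
move=> le_tx lt_xe; have lt_te := leq_ltn_trans le_tx lt_xe.
case: b mono cross_t {der min_t ex_t} => mono; last first.
  by have := ascending_gap mono le_st le_tx lt_xe; lia.
case: (ltngtP t x) le_tx => // [lt_tx _ | <-]; last lia.
by have := descending_lt mono le_st lt_tx lt_xe; lia.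
Qed.

(** * Counting by deletion of a fixed point *)

Lemma card_unique_witness (T I : finType) (A : {pred T}) (R : I -> pred T) :
  (forall p, p \in A -> exists t, R t p) ->
  (forall p t u, R t p -> R u p -> t = u) ->
  #|A| = \sum_(t : I) #|[set p in A | R t p]|.
Proof.
move=> exR uniqR; transitivity (\sum_(p in A) \sum_(t : I | R t p) 1).
  rewrite -sum1_card; apply: eq_bigr => p /exR[t Rt]; rewrite (big_pred1 t) // => u.
  by apply/idP/eqP => [/uniqR/(_ Rt) | ->].
rewrite (exchange_big_dep xpredT) //=; apply: eq_bigr => t _.
by rewrite -sum1_card; apply: eq_bigl => p; rewrite inE.
Qed.

Lemma lift_perm_surj (n : nat) (t : 'I_n.+1) (p : 'S_n.+1) :
  p t = t -> exists q : 'S_n, lift_perm t t q = p.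
Proof.
move=> fix_t.
have neq i : t != p (lift t i) by rewrite -{1}fix_t (inj_eq perm_inj) neq_lift.
pose q0 i := odflt i (unlift t (p (lift t i))).
have lift_q0 i : lift t (q0 i) = p (lift t i).
  by have /unlift_some[u eq_u eq_un] := neq i; rewrite /q0 eq_un.
have inj_q0 : injective q0.
  by move=> i l /(congr1 (lift t)); rewrite !lift_q0 => /perm_inj/lift_inj.
exists (perm inj_q0); apply/permP => x; case: (unliftP t x) => [i | ] ->.
  by rewrite lift_perm_lift permE lift_q0.
by rewrite lift_perm_id fix_t.
Qed.

Lemma card_lift_perm (n : nat) (t : 'I_n.+1) (P : pred 'S_n.+1) :
  (forall p, P p -> p t = t) ->
  #|[set p | P p]| = #|[set q : 'S_n | P (lift_perm t t q)]|.
Proof.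
have inj_lift : injective (@lift_perm n t t).
  move=> q r /permP eq_qr; apply/permP => i.
  by have := eq_qr (lift t i); rewrite !lift_perm_lift => /lift_inj.
move=> fixP; rewrite -(card_imset _ inj_lift).
apply: eq_card => p; rewrite inE; apply/idP/imsetP => [Pp | [q + ->]].
  have [q def_p] := lift_perm_surj (fixP p Pp).
  by exists q; rewrite // inE def_p.
by rewrite inE.
Qed.

Section Extensionality.
Variables (g h : nat -> nat) (eq_gh : g =1 h).

Lemma eq_block_monotone (k : nat) (S : {set 'I_k}) (a : 'I_k -> nat) :
  block_monotone S a g = block_monotone S a h.
Proof. by apply: eq_forallb => i; apply: eq_all => x; rewrite !eq_gh. Qed.

Lemma eq_block_deranged (k : nat) (a : 'I_k -> nat) (j : nat) :
  block_deranged a j g = block_deranged a j h.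
Proof. by apply: eq_forallb => i; congr (_ ==> _); apply: eq_all => x; rewrite eq_gh. Qed.

Lemma eq_first_fixed (s l t : nat) : first_fixed s l g t = first_fixed s l h t.
Proof.
by rewrite /first_fixed eq_gh; do 3!congr (_ && _); apply: eq_all => x; rewrite eq_gh.
Qed.

End Extensionality.

(** * Insertion of a fixed point into one block *)

Section InsertIntoBlock.
Variables (k : nat) (S : {set 'I_k}) (a : 'I_k -> nat) (j : 'I_k) (d : nat).
Let large : 'I_k -> nat := update a j d.+1.
Let small : 'I_k -> nat := update a j d.
Let s := block_start small j.

Lemma large_same : large j = d.+1. Proof. exact: update_same. Qed.
Lemma small_same : small j = d. Proof. exact: update_same. Qed.

Lemma block_start_large_le (i : 'I_k) : i <= j -> block_start large i = block_start small i.
Proof. by move=> le_ij; rewrite block_start_succ ltnNge le_ij addn0. Qed.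

Lemma block_start_large_gt (i : 'I_k) : j < i -> block_start large i = (block_start small i).+1.
Proof. by move=> lt_ji; rewrite block_start_succ lt_ji addn1. Qed.

(** Outside block j the insertion only relabels values by the increasing map
    [bump t]; positions before t are unchanged and those after t are shifted
    together with their block. *)
Lemma monotone_insert_before (t : nat) (g : nat -> nat) (i : 'I_k) :
  s <= t -> i < j ->
  monotone_on (i \in S) (block_start large i) (large i) (insert_fixed t g) =
  monotone_on (i \in S) (block_start small i) (small i) g.
Proof.
move=> le_st lt_ij; rewrite block_start_large_le ?(ltnW lt_ij) //.
have ne_ij : i != j by rewrite -val_eqE /= ltn_eqF.
have := block_end_start small lt_ij; rewrite -/s /large /small !update_other // => le_es.
apply: eq_in_all => x; rewrite mem_iota => x_in.
rewrite !insert_fixed_lt; try lia.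
by rewrite /monotone_step /bump; case: (i \in S); lia.
Qed.

Lemma monotone_insert_after (t : nat) (g : nat -> nat) (i : 'I_k) :
  t <= s + d -> j < i ->
  monotone_on (i \in S) (block_start large i) (large i) (insert_fixed t g) =
  monotone_on (i \in S) (block_start small i) (small i) g.
Proof.
move=> le_te lt_ji; rewrite block_start_large_gt //.
have ne_ij : i != j by rewrite -val_eqE /= gtn_eqF.
have := block_end_start small lt_ji; rewrite -/s small_same => le_es.
rewrite /monotone_on /large /small !update_other //.
rewrite -add1n iotaDl all_map; apply: eq_in_all => x; rewrite mem_iota /= => x_in.
rewrite !insert_fixed_gt; try (rewrite /small in le_es; lia).
by rewrite add1n /monotone_step /bump; case: (i \in S); lia.
Qed.

(** Blocks before j lie entirely below t, and [bump t] maps a value to x < t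
    only if that value is x itself. *)
Lemma deranged_insert (t : nat) (g : nat -> nat) :
  s <= t -> block_deranged large j (insert_fixed t g) = block_deranged small j g.
Proof.
move=> le_st; apply: eq_forallb => i; case: (ltnP i j) => //= lt_ij.
rewrite block_start_large_le ?(ltnW lt_ij) //.
have ne_ij : i != j by rewrite -val_eqE /= ltn_eqF.
have := block_end_start small lt_ij; rewrite -/s /large /small !update_other // => le_es.
apply: eq_in_all => x; rewrite mem_iota => x_in.
by rewrite insert_fixed_lt /bump; lia.
Qed.

Lemma insert_fixed_block (t : nat) (g : nat -> nat) :
  [&& block_monotone S large (insert_fixed t g), block_deranged large j (insert_fixed t g)
    & first_fixed s d.+1 (insert_fixed t g) t] =
  [&& block_monotone S small g, block_deranged small j g
    & crossing (j \in S) s d g t].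
Proof.
(* When t lies outside the range of insertion places both sides are false. *)
have [le_st | lt_ts] := leqP s t; last first.
  by rewrite /first_fixed /crossing [s <= t]leqNgt lt_ts !andbF.
have [le_te | lt_et] := leqP t (s + d); last first.
  rewrite /first_fixed /crossing [t <= s + d]leqNgt lt_et !andbF.
  by rewrite [t < _]ltnNge addnS lt_et !andbF.
rewrite deranged_insert // !(andbC (block_deranged _ _ _)) !andbA; congr (_ && _).
have eq_others (i : 'I_k) : i != j ->
    monotone_on (i \in S) (block_start large i) (large i) (insert_fixed t g) =
    monotone_on (i \in S) (block_start small i) (small i) g.
  rewrite -val_eqE /= neq_ltn => /orP[lt_ij | lt_ji].
    exact: monotone_insert_before.
  exact: monotone_insert_after.
have split_j (b : 'I_k -> nat) h : block_monotone S b h =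
    monotone_on (j \in S) (block_start b j) (b j) h &&
    [forall i, (i != j) ==> monotone_on (i \in S) (block_start b i) (b i) h].
  apply/forallP/andP => [mono | [mono_j /forallP mono] i].
    by split=> //; apply/forallP => i; apply/implyP.
  by have [-> // | ne_ij] := eqVneq i j; have := mono i; rewrite ne_ij.
rewrite !split_j block_start_large_le // -/s large_same small_same.
rewrite !(andbC _ [forall _, _]) -!andbA insert_fixed_crossing; congr (_ && _).
by apply: eq_forallb => i; case: eqVneq => //= /eq_others.
Qed.

(** Both sides split as a sum over t: the permutations on the left by their
    first fixed point in block j, those on the right by their crossing place.
    For each t the two parts correspond under [lift_perm t t]. *)
Lemma count_with_fixed_point :
  #|[set p : 'S_(total_size small).+1 |
      [&& block_monotone S large (nat_perm p), block_deranged large j (nat_perm p)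
        & ~~ deranged_on s d.+1 (nat_perm p)]]| =
  count_perms S (if j \in S then j.+1 else j) small.
Proof.
set n := total_size small.
rewrite (count_permsE S _ (erefl n)).
pose largeR (t : 'I_n.+1) : pred 'S_n.+1 := fun p => first_fixed s d.+1 (nat_perm p) t.
pose smallR (t : 'I_n.+1) : pred 'S_n := fun q => crossing (j \in S) s d (nat_perm q) t.
have le_en : s + d <= n by have := block_end_total small j; rewrite small_same.
rewrite (@card_unique_witness _ _ _ largeR); first last.
- by move=> p t u Rt Ru; apply/val_inj/(first_fixed_unique Rt Ru).
- move=> p; rewrite inE => /and3P[_ _ /first_fixed_exists[t fix_t]].
  have lt_tn : t < n.+1 by have /first_fixedP[_ ? _ _] := fix_t; lia.
  by exists (Ordinal lt_tn).
rewrite (@card_unique_witness _ _ _ smallR); first last.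
- by move=> p t u Rt Ru; apply/val_inj/(crossing_unique Rt Ru).
- move=> q; rewrite inE => /andP[/forallP/(_ j) mono der].
  have [||t cross_t] := @crossing_exists (j \in S) s d (nat_perm q).
  + by move: mono; rewrite small_same.
  + apply/implyP => j_in_S; move: der; rewrite j_in_S block_derangedS.
    by rewrite small_same => /andP[].
  have lt_tn : t < n.+1 by have /crossingP[_ ? _ _] := cross_t; lia.
  by exists (Ordinal lt_tn).
apply: eq_bigr => t _.
transitivity #|[set p : 'S_n.+1 | [&& block_monotone S large (nat_perm p),
    block_deranged large j (nat_perm p) & first_fixed s d.+1 (nat_perm p) t]]|.
  apply: eq_card => p; rewrite !inE /largeR -!andbA; do 2!congr (_ && _).
  apply: andb_idl => /first_fixedP[le_st lt_te fix_t _].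
  by apply/deranged_onP => /(_ t le_st lt_te).
rewrite (@card_lift_perm _ t); last first.
  move=> p /and3P[_ _ /first_fixedP[_ _ + _]].
  by rewrite nat_perm_val => /val_inj.
apply: eq_card => q; rewrite !inE /smallR (eq_block_monotone (nat_perm_lift t q)).
rewrite (eq_block_deranged (nat_perm_lift t q)).
rewrite (eq_first_fixed (nat_perm_lift t q)) insert_fixed_block -andbA.
(* In a descending block a crossing place already excludes fixed points. *)
case: ifP => // _; rewrite block_derangedS small_same -/s -andbA.
congr [&& _, _ & _]; apply/idP/andP => [cross | [] //]; split=> //.
have /crossingP[le_st le_te below above] := cross.
apply/deranged_onP => x le_sx lt_xe; have := below x; have := above x; lia.
Qed.

Lemma count_perms_succ :
  count_perms S j large =
  count_perms S j.+1 large + count_perms S (if j \in S then j.+1 else j) small.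
Proof.
rewrite -count_with_fixed_point !(count_permsE S _ (total_size_succ a j d)) -/large -/small.
set A := [set p | _ && _]; rewrite -(cardsID [set p | deranged_on s d.+1 (nat_perm p)] A).
congr (_ + _); apply: eq_card => p; rewrite !inE.
  by rewrite block_derangedS large_same block_start_large_le // andbA.
by rewrite andbC andbA.
Qed.

End InsertIntoBlock.

(** * The recurrence *)

Lemma count_perms_empty (k : nat) (S : {set 'I_k}) (a : 'I_k -> nat) (j : 'I_k) :
  a j = 0 -> count_perms S j a = count_perms S j.+1 a.
Proof.
move=> a0; rewrite !(count_permsE S _ erefl); apply: eq_card => p.
by rewrite !inE block_derangedS a0 andbT.
Qed.

Lemma count_perms_ascending (k : nat) (S : {set 'I_k}) (a : 'I_k -> nat)
    (j : 'I_k) (d : nat) :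
  j \notin S ->
  count_perms S j (update a j d) =
  \sum_(0 <= h < d.+1) count_perms S j.+1 (update a j (d - h)).
Proof.
move=> /negPf asc_j; elim: d => [|d IHd].
  by rewrite big_nat1 count_perms_empty ?update_same.
by rewrite count_perms_succ asc_j IHd [RHS]big_nat_recl // subn0.
Qed.

Lemma f_nat (k : nat) (S : {set 'I_k}) (j : nat) (a : 'I_k -> nat) :
  f S j (fun i => Posz (a i)) = count_perms S j a.
Proof. by rewrite /f; case: forallP => // -[]. Qed.

(** For h above the block size some argument of [f] is negative; this happens
    in the theorem only for an empty descending block. *)
Lemma f_decrease (k : nat) (S : {set 'I_k}) (c : 'I_k -> nat) (i : nat)
    (j : 'I_k) (h : nat) :
  f S i (fun l => if l == j then (Posz (c l) - Posz h)%R else Posz (c l)) =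
  if h <= c j then count_perms S i (update c j (c j - h)) else 0.
Proof.
rewrite /f; case: leqP => [le_hc | lt_ch]; last first.
  by case: forallP => // /(_ j); rewrite eqxx; lia.
case: forallP => [_ | []].
  by apply: eq_count_perms => l; rewrite /update; case: eqP => // ->; lia.
by move=> l; case: eqP => [-> | _]; lia.
Qed.

Lemma update_id (k : nat) (a : 'I_k -> nat) (j : 'I_k) : update a j (a j) =1 a.
Proof. by move=> i; rewrite /update; case: eqP => // ->. Qed.

Theorem proposition2p6 (k : nat) (k_ge1 : 1 <= k) (S : {set 'I_k})
    (c : 'I_k -> nat) (j : nat) (lt_jk : j < k) :
  f S j (fun i => Posz (c i)) =
  \sum_(0 <= h < (m S c (Ordinal lt_jk)).+1)
    f S j.+1 (fun i =>
      if i == Ordinal lt_jk then (Posz (c i) - Posz h)%R else Posz (c i)).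
Proof.
rewrite f_nat; set jo := Ordinal lt_jk; rewrite -[j]/(val jo).
rewrite -(eq_count_perms _ _ (update_id c jo)) /m.
case: ifPn => [desc_j | asc_j]; last first.
  rewrite count_perms_ascending //; apply: eq_big_nat => h /andP[_ lt_hc].
  by rewrite f_decrease -ltnS lt_hc.
rewrite big_nat_recl // big_nat1 !f_decrease leq0n subn0 subn1.
case: (c jo) => [|d]; first by rewrite addn0 count_perms_empty ?update_same.
by rewrite count_perms_succ desc_j.
Qed.
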